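(* Let $D$ be the unit simplex $\{(p_0,\ldots,p_K)\in[0,1]^{K+1}:\sum_k p_k=1\}$ and let $Y$ be a finite set of real numbers. If every level set of a function $h:D\to Y$ is Lebesgue measurable, then for every $\epsilon>0$ there exists a computable box function $h_\epsilon:D\to Y$ such that the set $\{p\in D: h(p)\ne h_\epsilon(p)\}$ has measure at most $\epsilon$.
   Context: Measure on $D$ is $K$-dimensional Lebesgue measure. A rational open box is a set $\prod_{k=0}^K(a_k,b_k)$ with all $a_k,b_k$ rational. A box function is a function that can be written as a finite sum $\sum_i a_i1_{B_i}$, where the $B_i$ are rational open boxes and $1_{B_i}$ their indicator functions (restricted to $D$). Let $X=\{0,1,\ldots,K\}$. For $x\in X^n$, $p_k(x)=|\{i:x_i=k\}|/n$. A function $h:D\to Y$ is computable if the family $f_n:X^n\to Y$, $f_n(x)=h(p_0(x),\ldots,p_K(x))$, is computable in the following model. A network is a triple $(n,G,\mathcal L)$: $G$ is a connected undirected graph without self-arcs on $n\ge2$ nodes $\{1,\ldots,n\}$; $d(i)$ is the degree of node $i$; the port labeling $\mathcal L$ assigns to the edges at each node $i$ distinct port numbers in $\{0,1,\ldots,d(i)\}$. An algorithm is a family of deterministic finite automata $(A_d)_{d=1,2,\ldots}$, where $A_d$ is a map from $X\times Z_d\times(Y\cup\{\emptyset\})\times M^d$ into itself not changing the $X$-component. Here the internal memory set $Z_d$, the output set $Y$ and the message set $M$ are finite, $Z_d$ and $M$ contain a default symbol $\emptyset$, and $Z_d$ may depend on $d$; none of these depend on $n$. Node $i$ starts with initial value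 $x_i\in X$, with memory $z_i(0)$, output $y_i(0)$ and all outgoing messages equal to $\emptyset$. Let $j_1,\ldots,j_{d(i)}$ be the neighbors of $i$ in the order of the port numbers at $i$, and let $p_k$ be the index, in the corresponding enumeration at node $j_k$, of the edge from $j_k$ to $i$. At each time step every node $i$ updates synchronously $$[x_i,z_i(t+1),y_i(t+1);m_{i,1}(t+1),\ldots,m_{i,d(i)}(t+1)]=A_{d(i)}[x_i,z_i(t),y_i(t);m_{j_1,p_1}(t),\ldots,m_{j_{d(i)},p_{d(i)}}(t)].$$ The algorithm terminates with final output $y^*\in Y$ if there is a time $t'$ with $y_i(t)=y^*$ for all $i$ and all $t\ge t'$. The family $(f_n)$ is computable if there is a family $(A_d)$ such that for every $n$, every network with $n$ nodes, and all initial values $x_1,\ldots,x_n$, the algorithm terminates with final output $f_n(x_1,\ldots,x_n)$. *)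

(* Defs.v *)
From HB Require Import structures.
From mathcomp Require Import all_boot all_order all_algebra finmap.
From mathcomp Require Import all_classical all_reals all_analysis.
Set Implicit Arguments.
Unset Strict Implicit.
Unset Printing Implicit Defensive.
Import Order.TTheory GRing.Theory Num.Theory.
Local Open Scope classical_set_scope.
Local Open Scope ring_scope.

Section Networks.

Record network (n : nat) := Network {
  net_size : (1 < n)%N;
  adj : rel 'I_n;
  adj_sym : symmetric adj;
  adj_irr : irreflexive adj;
  adj_conn : forall i j, connect adj i j;
  (* port i j is the label at node i of the edge {i, j}; its value is only
     relevant when i and j are adjacent *)
  port : 'I_n -> 'I_n -> nat;
  port_le : forall i j, adj i j -> (port i j <= #|adj i|)%N;
  port_inj : forall i, {in adj i &, injective (port i)} }.

Definition degree n (N : network n) (i : 'I_n) : nat := #|adj N i|.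

Definition neighbors n (N : network n) (i : 'I_n) :
    (degree N i).-tuple 'I_n :=
  [tuple of sort (fun j k => port N i j <= port N i k)%N (enum (adj N i))].

Definition node_state (X Y Z M : Type) (d : nat) : Type :=
  X * Z * option Y * d.-tuple M.

(* The default output is None.  The automaton of index 0 is never run, since
   every node of a network has a neighbor. *)
Record algorithm (X Y : finType) := Algorithm {
  memory : nat -> finType;
  memory0 : forall d, memory d;
  message : finType;
  message0 : message;
  automaton : forall d : nat,
    node_state X Y (memory d) message d -> node_state X Y (memory d) message d;
  automaton_input : forall d s, (automaton (d := d) s).1.1.1 = s.1.1.1 }.

Section Execution.
Variables (X Y : finType) (A : algorithm X Y) (n : nat) (N : network n).

Definition configuration : Type := forall i : 'I_n,
  node_state X Y (memory A (degree N i)) (message A) (degree N i).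

Definition initial (x : {ffun 'I_n -> X}) : configuration := fun i =>
  (x i, memory0 A (degree N i), None,
   [tuple of nseq (degree N i) (message0 A)]).

(* Node i receives from its neighbor j the message which j emitted on the edge
   to i, at position index i (neighbors N j) among the messages emitted by j.
   This position is in range by symmetry of adj, so that the default value of
   nth is not used. *)
Definition received (c : configuration) (i : 'I_n) :
    (degree N i).-tuple (message A) :=
  [tuple of [seq nth (message0 A) (c j).2 (index i (neighbors N j))
            | j <- neighbors N i]].

Definition step (c : configuration) : configuration := fun i =>
  automaton ((c i).1, received c i).

Definition run (x : {ffun 'I_n -> X}) (t : nat) : configuration :=
  iter t step (initial x).

Definition output (c : configuration) (i : 'I_n) : option Y := (c i).1.2.

Definition terminates_with (x : {ffun 'I_n -> X}) (y : Y) : Prop :=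
  exists t' : nat, forall (i : 'I_n) (t : nat), (t' <= t)%N ->
    output (run x t) i = Some y.

End Execution.

Definition computable_family (X Y : finType)
    (f : forall n : nat, (1 < n)%N -> {ffun 'I_n -> X} -> Y) : Prop :=
  exists A : algorithm X Y, forall (n : nat) (N : network n)
    (x : {ffun 'I_n -> X}), terminates_with A N x (f n (net_size N) x).

End Networks.

Section Boxes.
Variable R : realType.

Definition open_box m (a b : 'rV[R]_m) : set 'rV[R]_m :=
  [set x | forall k, a 0 k < x 0 k < b 0 k].

Definition volume m (a b : 'rV[R]_m) : R := \prod_k (b 0 k - a 0 k).

(* Lebesgue outer measure on R^m.  The covers are countable sets of
   nondegenerate boxes, given by pairs of opposite corners; finite and empty
   covers are allowed, so that the case m = 0 gives the counting measure. *)
Definition box_cover m (S : set 'rV[R]_m) (C : set ('rV[R]_m * 'rV[R]_m)) :=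
  [/\ countable C,
      forall B, C B -> forall k, B.1 0 k < B.2 0 k &
      S `<=` \bigcup_(B in C) open_box B.1 B.2].

Definition lebesgue_outer m (S : set 'rV[R]_m) : \bar R :=
  ereal_inf [set (\esum_(B in C) (volume B.1 B.2)%:E)%E | C in box_cover S].

End Boxes.

Section Simplex.
Variables (R : realType) (K : nat).

Definition in_simplex (p : 'rV[R]_K.+1) : bool :=
  [forall k, 0 <= p 0 k <= 1] && (\sum_k p 0 k == 1).

Definition simplex : Type := {p : 'rV[R]_K.+1 | in_simplex p}.

(* The K-dimensional Lebesgue measure on the simplex is taken in the affine
   coordinates (p_1, ..., p_K); the Euclidean surface measure is sqrt (K + 1)
   times this one.  It is extended to all sets as an outer measure, whose
   measurable sets are the Lebesgue measurable sets. *)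
Definition simplex_coord (p : simplex) : 'rV[R]_K :=
  \row_k val p 0 (lift ord0 k).

Definition simplex_measurable (S : set simplex) : Prop :=
  caratheodory_measurable (@lebesgue_outer R K) (simplex_coord @` S).

Definition simplex_measure (S : set simplex) : \bar R :=
  lebesgue_outer (simplex_coord @` S).

Definition freq n (x : {ffun 'I_n -> 'I_K.+1}) : 'rV[R]_K.+1 :=
  \row_k (#|[pred i | x i == k]|%:R / n%:R).

Lemma freq_in_simplex n (x : {ffun 'I_n -> 'I_K.+1}) :
  (1 < n)%N -> in_simplex (freq x).
Proof.
move=> n1; have n0 : (0 : R) < n%:R by rewrite ltr0n (ltn_trans _ n1).
apply/andP; split.
  apply/forallP => k; rewrite mxE divr_ge0 ?ler0n//=.
  by rewrite ler_pdivrMr// mul1r ler_nat -[leqRHS](card_ord n) max_card.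
under eq_bigr do rewrite mxE.
rewrite -mulr_suml -natr_sum.
suff -> : (\sum_k #|[pred i | x i == k]|)%N = n.
  by rewrite divff// lt0r_neq0.
rewrite -[RHS](card_ord n) -sum1_card (partition_big x predT)//=.
by apply: eq_bigr => k _; rewrite -sum1_card.
Qed.

Definition freq_simplex n (n1 : (1 < n)%N) (x : {ffun 'I_n -> 'I_K.+1}) :
  simplex := exist _ (freq x) (freq_in_simplex x n1).

Definition computable_on_simplex (Y : finType) (h : simplex -> Y) : Prop :=
  computable_family (fun n (n1 : (1 < n)%N) (x : {ffun 'I_n -> 'I_K.+1}) =>
    h (freq_simplex n1 x)).

Definition rational_box (a b : 'rV[rat]_K.+1) : set 'rV[R]_K.+1 :=
  open_box (map_mx ratr a) (map_mx ratr b).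

Definition box_function (g : simplex -> R) : Prop :=
  exists s : seq (R * ('rV[rat]_K.+1 * 'rV[rat]_K.+1)),
  forall p : simplex,
    g p = \sum_(c <- s) c.1 * \1_(rational_box c.2.1 c.2.2) (val p).

End Simplex.

(* Main.v *)
(* Computability.  A box function is a Boolean combination of comparisons of a
   frequency with a rational, that is, of conditions
   \sum_i wn (x i) < \sum_i wp (x i) with nonnegative integer weights.  Node i
   starts with wp (x i) units of credit, which stay at i, and with wn (x i) debt
   tokens, which walk: a node emits the tokens it received in cyclic port order,
   and a token reaching a node with credit annihilates one unit.  Once the
   credits no longer change, a token visiting some node infinitely often visits
   all nodes infinitely often; so either no credit or no token remains, and the
   condition holds iff credit remains.  The nodes learn this from
   Greenberg-Hastings waves: colors modulo 3 advance at nodes with credit, at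
   nodes of nonzero color, and next to a node of color 1.  Colors lift to
   integer heights which differ by at most 1 along edges; without sources the
   maximal height is bounded and the waves die out, whereas a persistent source
   ends up driving every node at each step.  So each node outputs whether its
   color has just changed.

   Approximation.  Up to a small measure, a measurable level set S is a finite
   union U of rational boxes: cover S by boxes of total volume close to its
   measure, drop a small tail, and enlarge the remaining boxes slightly; the
   excess of U over S is controlled by Caratheodory's condition for S. *)
Require Import Defs.
From HB Require Import structures.
From mathcomp Require Import all_boot all_order all_algebra finmap.
From mathcomp Require Import all_classical all_reals all_analysis.
From mathcomp Require Import zify ring lra.
Set Implicit Arguments.
Unset Strict Implicit.
Unset Printing Implicit Defensive.
Import Order.TTheory GRing.Theory Num.Theory.
Local Open Scope classical_set_scope.
Local Open Scope ring_scope.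

(** * Eventually constant sequences of natural numbers *)

Section EventuallyStationary.
Local Open Scope nat_scope.

(** Induction on a bound for the gap [B - u T]: if [u] is not constant from [T] on, it exceeds [u T]
    at some later time, where the gap is smaller. *)
Lemma nondecreasing_bounded_stationary (u : nat -> nat) (B T : nat) :
  (forall t, T <= t -> u t <= u t.+1) -> (forall t, T <= t -> u t <= B) ->
  exists2 T', T <= T' & forall t, T' <= t -> u t = u T'.
Proof.
move=> umono.
have umonoD m k : T <= m -> u m <= u (m + k).
  move=> Tm; elim: k => [|k IH]; first by rewrite addn0.
  by rewrite addnS (leq_trans IH)// umono// (leq_trans Tm)// leq_addr.
move: {2}(B - u T) (leqnn (B - u T)) => k.
elim: k T umono umonoD => [|k IH] T umono umonoD Bk uB.
  exists T => // t Tt; apply/eqP; rewrite eqn_leq.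
  have := umonoD T (t - T) (leqnn _); rewrite subnKC// => ->.
  by rewrite andbT; have := uB t Tt; lia.
have [cst|/existsNP[t /not_implyP[Tt ut]]] :=
  pselect (forall t, T <= t -> u t = u T); first by exists T.
have uTt := umonoD T (t - T) (leqnn _); rewrite subnKC// in uTt.
have uBt := uB t Tt.
have [s ts|s m ts||s ts|T' tT' cst] := IH t.
- by apply: umono; lia.
- by apply: umonoD; lia.
- by move: ut uTt uBt Bk => /eqP; lia.
- by apply: uB; lia.
by exists T'; [lia|].
Qed.

Lemma nonincreasing_stationary (u : nat -> nat) :
  (forall t, u t.+1 <= u t) -> exists T, forall t, T <= t -> u t = u T.
Proof.
move=> udec.
have u0 t : u t <= u 0 by elim: t => // t; apply: leq_trans.
have [t _|t _|T _ cst] :=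
  @nondecreasing_bounded_stationary (fun t => u 0 - u t) (u 0) 0.
- by have := udec t; lia.
- by lia.
exists T => t Tt; have := cst _ Tt; have := u0 t; have := u0 T; lia.
Qed.

Lemma finite_eventually (I : finType) (P : I -> nat -> Prop) :
  (forall i, exists T, forall t, T <= t -> P i t) ->
  exists T, forall i t, T <= t -> P i t.
Proof.
move=> /choice[T PT]; exists (\max_i T i) => i t Tt.
by apply: PT; apply: leq_trans Tt; apply: leq_bigmax.
Qed.

End EventuallyStationary.

(** * Tokens and waves *)

Section TokensAndWaves.
Local Open Scope nat_scope.

(* The number of s < m congruent to k modulo d, for k < d: what has left
   through port k when m tokens have been emitted in cyclic port order. *)
Definition quota (d k m : nat) : nat := (m + (d.-1 - k)) %/ d.

(** Hermite's identity. Raising [m] by one shifts the summands by one place, and the new last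
    summand exceeds the lost first one by one. *)
Lemma quota_sum d m : 0 < d -> \sum_(k < d) quota d k m = m.
Proof.
move=> d0; rewrite (reindex_inj rev_ord_inj)/=.
under eq_bigr => k _.
  rewrite /quota (_ : d.-1 - (d - k.+1) = k); last by have := ltn_ord k; lia.
over.
case: d d0 => // d _; elim: m => [|m IH].
  by apply: big1 => k _; rewrite add0n divn_small.
rewrite big_ord_recr/= -[in RHS]IH big_ord_recl/= addn0 addSnnS.
rewrite divnDr// divnn addn1 addnS; congr _.+1.
by rewrite addnC; congr addn; apply: eq_bigr => k _; rewrite addSnnS.
Qed.

Lemma leq_quota d k : {homo quota d k : m m' / m <= m'}.
Proof. by move=> m m' mm'; apply: leq_div2r; rewrite leq_add2r. Qed.

(** Full rounds through the ports shift both quotas equally, so only the position in the current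
    round matters. This lets an automaton keep [emitted] modulo the degree. *)
Lemma quotaD_mod d k m c :
  quota d k (m + c) - quota d k m = quota d k (m %% d + c) - quota d k (m %% d).
Proof.
have [->|d0] := posnP d; first by rewrite /quota !divn0.
have E e : quota d k (m + e) = m %/ d + quota d k (m %% d + e).
  by rewrite /quota {1}(divn_eq m d) -!addnA divnMDl.
by have := E c; have := E 0; rewrite !addn0; lia.
Qed.

(** Quotas are monotone, and [L] full rounds raise each of them by exactly [L]. *)
Lemma quota_sub_le d k m c L :
  0 < d -> c <= L * d -> quota d k (m + c) - quota d k m <= L.
Proof.
move=> d0 cL; rewrite leq_subLR /quota.
have -> : (m + (d.-1 - k)) %/ d + L = (m + (d.-1 - k) + L * d) %/ d.
  by rewrite divnDMl.
by apply: leq_div2r; lia.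
Qed.

(** In cyclic order, the traffic of a single port bounds the total emission; [moving_vanishes] rests
    on this. *)
Lemma ltn_quota_bound d k m : 0 < d -> m < (quota d k m).+1 * d.
Proof.
move=> d0; apply: leq_ltn_trans (ltn_ceil _ d0); exact: leq_addr.
Qed.

Section Network.
Variables (n : nat) (N : network n).
Implicit Types i j : 'I_n.

Lemma mem_neighbors i j : (j \in neighbors N i) = adj N i j.
Proof. by rewrite mem_sort mem_enum. Qed.

Lemma neighbors_uniq i : uniq (neighbors N i).
Proof. by rewrite sort_uniq enum_uniq. Qed.

Lemma big_neighbors i (F : 'I_n -> nat) :
  \sum_(j <- neighbors N i) F j = \sum_(j | adj N i j) F j.
Proof.
rewrite -[RHS]big_enum/=; by apply: perm_big; rewrite perm_sort.
Qed.

Lemma degree_gt0 i : 0 < degree N i.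
Proof.
have [j ji] : exists j, j != i.
  have [i0|i0] := eqVneq (i : nat) 0.
    by exists (Ordinal (net_size N)); rewrite -val_eqE/= i0.
  exists (Ordinal (ltnW (net_size N))).
  by rewrite -val_eqE/= eq_sym.
have /connectP[[|k p]/=] := adj_conn N i j.
  by move=> _ ji'; rewrite ji' eqxx in ji.
by move=> /andP[ik _] _; apply/card_gt0P; exists k.
Qed.

Lemma network_ind (P : 'I_n -> Prop) i0 :
  P i0 -> (forall i j, adj N i j -> P i -> P j) -> forall i, P i.
Proof.
move=> P0 Padj i; have /connectP[p] := adj_conn N i0 i.
elim: p i0 P0 => [|k p IH] i0 P0 /=; first by move=> _ ->.
by move=> /andP[/Padj/(_ P0)/IH]; exact.
Qed.

Definition port_index j i : nat := index i (neighbors N j).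

Lemma sum_port_index j (F : nat -> nat) :
  \sum_(i | adj N j i) F (port_index j i) = \sum_(k < degree N j) F k.
Proof.
rewrite -big_neighbors (big_nth j) size_tuple big_mkord.
apply: eq_bigr => k _; congr F.
by rewrite /port_index index_uniq ?size_tuple// neighbors_uniq.
Qed.

(* An unbounded version of the algorithm.  The automaton only remembers
   emitted modulo the degree and height modulo 3. *)
Record ledger := Ledger {
  credit : 'I_n -> nat; emitted_before : 'I_n -> nat;
  emitted : 'I_n -> nat; height : 'I_n -> nat }.

Definition flow (c : ledger) j k : nat :=
  quota (degree N j) k (emitted c j) -
  quota (degree N j) k (emitted_before c j).

Definition inflow c i : nat :=
  \sum_(j <- neighbors N i) flow c j (port_index j i).

Definition fires c i : bool :=
  [|| height c i %% 3 != 0, 0 < credit c i |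
      has (fun j => height c j %% 3 == 1) (neighbors N i)].

Definition ledger_step c : ledger := {|
  credit := fun i => credit c i - inflow c i;
  emitted_before := emitted c;
  emitted := fun i => emitted c i + (inflow c i - credit c i);
  height := fun i => height c i + fires c i |}.

Variables wp wn : 'I_n -> nat.

Definition ledger_at t : ledger :=
  iter t ledger_step (Ledger wp (fun=> 0) wn (fun=> 0)).

Let a t i := credit (ledger_at t) i.
Let s t i := emitted (ledger_at t) i.
Let h t i := height (ledger_at t) i.
Let r t i := inflow (ledger_at t) i.
Let moving t i := s t i - emitted_before (ledger_at t) i.

Lemma credit_step t i : a t.+1 i = a t i - r t i.
Proof. by []. Qed.

Lemma emitted_step t i : s t.+1 i = s t i + (r t i - a t i).
Proof. by []. Qed.

Lemma height_step t i : h t.+1 i = h t i + fires (ledger_at t) i.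
Proof. by []. Qed.

Lemma emitted_before_le t i : emitted_before (ledger_at t) i <= s t i.
Proof. by case: t => //= t; rewrite /s/= leq_addr. Qed.

(** No token is lost in transit: once the sum over edges is grouped by sender, the quotas of the
    ports of a node add up to its emission. *)
Lemma sum_inflow t : \sum_i r t i = \sum_i moving t i.
Proof.
rewrite /r /inflow; under eq_bigr do rewrite big_neighbors.
rewrite (exchange_big_dep predT)//=; apply: eq_bigr => j _.
rewrite (eq_bigl (adj N j)); last by move=> i; rewrite adj_sym.
rewrite (sum_port_index j (flow (ledger_at t) j)) /flow sumnB.
  by rewrite !quota_sum ?degree_gt0.
by move=> k _; apply/leq_quota/emitted_before_le.
Qed.

(** Invariant that keeps messages finite: a node reached by at most [L] tokens per edge emits at
    most [L] times its degree, which the cyclic order spreads with at most [L] per port. *)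
Lemma moving_le L t i : (forall i, wn i <= L) ->
  moving t i <= L * degree N i.
Proof.
move=> wnL; elim: t i => [|t IH] i.
  rewrite /moving subn0 (leq_trans (wnL i))//.
  by rewrite leq_pmulr// degree_gt0.
rewrite /moving /s/= addKn (leq_trans (leq_subr _ _))//.
rewrite /inflow big_neighbors /degree mulnC -sum_nat_const.
apply: leq_sum => j _.
rewrite /flow -[X in quota _ _ X](subnKC (emitted_before_le t j)).
by apply: quota_sub_le; [exact: degree_gt0|exact: IH].
Qed.

Lemma flow_le L t j k : (forall i, wn i <= L) -> flow (ledger_at t) j k <= L.
Proof.
move=> wnL; rewrite /flow -[X in quota _ _ X](subnKC (emitted_before_le t j)).
by apply: quota_sub_le; [exact: degree_gt0|exact: moving_le].
Qed.

Lemma credit_le L t i : (forall i, wp i <= L) -> a t i <= L.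
Proof.
move=> wpL; elim: t => [|t IH]; first exact: wpL.
by rewrite /a/= (leq_trans (leq_subr _ _)).
Qed.

(** An annihilation removes one credit and one token together, so their difference is invariant. *)
Lemma conservation t :
  \sum_i a t i + \sum_i wn i = \sum_i moving t i + \sum_i wp i.
Proof.
elim: t => [|t IH].
  by rewrite addnC; congr addn; apply: eq_bigr => i _; rewrite /moving subn0.
have E : \sum_i a t.+1 i + \sum_i r t i = \sum_i moving t.+1 i + \sum_i a t i.
  rewrite -!big_split/=; apply: eq_bigr => i _.
  by rewrite /moving /a /s /r/= addKn; lia.
by move: E; rewrite sum_inflow; lia.
Qed.

Lemma credit_stationary : exists T, forall t, T <= t -> forall i, a t i = a T i.
Proof.
have [T aT] : exists T, forall i t, T <= t -> a t.+1 i = a t i.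
  apply: finite_eventually => i.
  have [t|T aT] := @nonincreasing_stationary (a^~ i).
    by rewrite /a/= leq_subr.
  by exists T => t Tt; rewrite !aT// leqW.
exists T => t Tt i.
rewrite -(subnKC Tt); elim: (t - T) => [|k IH]; first by rewrite addn0.
by rewrite addnS aT// leq_addr.
Qed.

(** A token reaching [i0] would consume credit, so [i0] receives nothing and emits nothing more.
    Finiteness of the total emission then spreads along edges to all nodes. *)
Lemma moving_vanishes T i0 : (forall t, T <= t -> forall i, a t i = a T i) ->
  0 < a T i0 -> exists T', forall t, T' <= t -> forall i, moving t i = 0.
Proof.
move=> aT ai0.
have aS t i : T <= t -> a t i - r t i = a t i.
  by move=> Tt; rewrite -credit_step !aT// leqW.
have Q : forall i, exists T', forall t, T' <= t -> s t i = s T' i.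
  apply: (@network_ind _ i0) => [|i j ij [T' sT']].
    exists T => t Tt; rewrite -(subnKC Tt); elim: (t - T) => [|k IH].
      by rewrite addn0.
    have Tk : T <= T + k by exact: leq_addr.
    have := aS _ i0 Tk; rewrite addnS emitted_step IH (aT _ Tk).
    by move: ai0; lia.
  pose T1 := maxn T T'; pose k := port_index j i.
  (* An arriving token would either lower the credit of [i] or be emitted again, and both have
     stopped. *)
  have r0 t : T1 <= t -> r t i = 0.
    move=> Tt; have Tt1 : T <= t by move: Tt; rewrite /T1; lia.
    have Tt2 : T' <= t by move: Tt; rewrite /T1; lia.
    have := aS _ i Tt1; have := sT' t.+1 (leqW Tt2).
    by rewrite -(sT' t Tt2) emitted_step; lia.
  have q0 t : T1 <= t -> quota (degree N j) k (s t j) =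
      quota (degree N j) k (emitted_before (ledger_at t) j).
    move=> /r0/eqP; rewrite /r /inflow big_neighbors sum_nat_eq0.
    move=> /forallP/(_ j); rewrite ij/= => /eqP; rewrite /flow -/k -/(s t j).
    by have := @leq_quota (degree N j) k _ _ (emitted_before_le t j); lia.
  have qc t : T1 <= t -> quota (degree N j) k (s t j) =
      quota (degree N j) k (s T1 j).
    move=> Tt; rewrite -(subnKC Tt); elim: (t - T1) => [|u IH].
      by rewrite addn0.
    by rewrite addnS q0 ?leqW ?leq_addr//= -IH.
  (* The port of [j] towards [i] has become silent, which bounds the total emission of [j]. *)
  have [t _|t Tt|T2 _ ?] := @nondecreasing_bounded_stationary (s^~ j)
      ((quota (degree N j) k (s T1 j)).+1 * degree N j) T1.
  - by rewrite /s/= leq_addr.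
  - by rewrite -(qc t Tt) ltnW// ltn_quota_bound// degree_gt0.
  - by exists T2.
have [T1 sT1] : exists T1, forall i t, T1 <= t -> s t.+1 i = s t i.
  apply: finite_eventually => i; have [T' sT'] := Q i.
  by exists T' => t Tt; rewrite !sT'// leqW.
exists T1.+1 => -[//|t] Tt i.
by rewrite /moving sT1// subnn.
Qed.

Lemma credit_decides : exists T,
  (forall t, T <= t -> forall i, a t i = a T i) /\
  ((\sum_i wn i < \sum_i wp i) <-> exists i, 0 < a T i).
Proof.
have [T aT] := credit_stationary; exists T; split=> //; split.
  move=> wlt; have [[i ai]|/forallNP a0] := pselect (exists i, 0 < a T i).
    by exists i.
  (* Without credit left, conservation makes the initial debt at least the initial credit. *)
  have := conservation T; rewrite [X in X + _ = _]big1 => [|i _]; first by lia.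
  by have := a0 i; lia.
(* Once no token moves, conservation equates the initial surplus with the remaining credit, which is
   positive. *)
move=> [i ai]; have [T' mT'] := moving_vanishes aT ai.
have := conservation (maxn T T'); rewrite [X in _ = X + _]big1.
  move=> E; suff: 0 < \sum_i a (maxn T T') i by lia.
  by rewrite (bigD1 i)//= (aT _ (leq_maxl _ _)) ltn_addr.
by move=> j _; apply: mT'; exact: leq_maxr.
Qed.

(** The bound could only break when [h t i = (h t j).+1] and [j] stays idle. But an idle node has
    color 0, so [i] would have color 1 and make [j] fire. *)
Lemma height_adj t i j : adj N i j -> h t i <= (h t j).+1.
Proof.
elim: t i j => // t IH i j ij; rewrite /h/= -/(h t i) -/(h t j).
have hij := IH i j ij.
have [fj|fj] := boolP (fires (ledger_at t) j).
  by case: fires; lia.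
have [hle|hgt] := leqP (h t i) (h t j); first by case: fires; lia.
have E : h t i = (h t j).+1 by lia.
move: fj; rewrite /fires !negb_or negbK => /and3P[/eqP hj _ /hasPn/(_ i)].
rewrite mem_neighbors adj_sym ij => /(_ isT).
by move: hj; rewrite -/(h t i) -/(h t j) E; lia.
Qed.

Lemma waves_die T : (forall t, T <= t -> forall i, a t i = 0) ->
  exists T', forall i t, T' <= t -> h t.+1 i = h t i.
Proof.
(* [B] is a multiple of 3 above all heights at time [T]. A node at height [B] has color 0 and no
   credit, and its neighbors, at height [B] or [B - 1], have color 0 or 2; so it never rises. *)
move=> a0; pose B := 3 * \max_i h T i.
have hB t i : T <= t -> h t i <= B.
  move=> Tt; rewrite -(subnKC Tt); elim: (t - T) i => [|k IH] i.
    by rewrite addn0 /B (leq_trans (leq_bigmax i))//; lia.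
  rewrite addnS height_step.
  have [|lt] := ltnP (h (T + k) i) B; first by case: fires; lia.
  have E : h (T + k) i = B by have := IH i; lia.
  rewrite E /fires -/(h (T + k) i) -/(a (T + k) i) E a0 ?leq_addr//.
  rewrite /B mulnC modnMl/=; case: hasP => [[j ij /eqP hj]|]; last by lia.
  have := IH j; rewrite mem_neighbors in ij; have := height_adj (T + k) ij.
  by rewrite E; move: hj; rewrite -/(h (T + k) j) /B; lia.
apply: finite_eventually => i.
have [t _|t Tt|T1 _ hT1] := @nondecreasing_bounded_stationary (h^~ i) B T.
- by rewrite height_step leq_addr.
- exact: hB.
by exists T1 => t Tt; rewrite !hT1// leqW.
Qed.

(* A persistent source fires at each step, and the heights of neighbors differ
   by at most 1, so that the delay t - h t i is bounded; as it is monotone, each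
   node ends up firing at each step. *)
Lemma waves_persist T i0 : (forall t, T <= t -> 0 < a t i0) ->
  exists T', forall i t, T' <= t -> h t.+1 i = (h t i).+1.
Proof.
move=> ai0.
have hle t i : h t i <= t.
  by elim: t => // t; rewrite height_step; case: fires; lia.
have [D hD] : exists D, forall t, T <= t -> t - h t i0 <= D.
  exists T => t Tt; rewrite -(subnKC Tt).
  elim: (t - T) => [|k IH]; first by lia.
  by rewrite addnS height_step /fires -/(a _ i0) ai0 ?leq_addr//= orbT; lia.
have Q : forall i, exists D, forall t, T <= t -> t - h t i <= D.
  apply: (@network_ind _ i0) => [|i j ij [D' hD']]; first by exists D.
  by exists D'.+1 => t Tt; have := hD' t Tt; have := height_adj t ij; lia.
apply: finite_eventually => i; have [D' hD'] := Q i.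
have [t _||T1 _ hT1] :=
  @nondecreasing_bounded_stationary (fun t => t - h t i) D' T.
- by rewrite height_step; have := hle t i; case: fires; lia.
- exact: hD'.
exists T1 => t Tt; have := hT1 t.+1 (leqW Tt); rewrite -(hT1 t Tt).
have := hle t i; have := hle t.+1 i; have := height_step t i.
by case: fires; lia.
Qed.

Lemma waves_decide : exists T, forall i t, T <= t ->
  (h t.+1 i != h t i) = (\sum_i wn i < \sum_i wp i).
Proof.
have [T [aT dec]] := credit_decides.
have [lt|ge] := boolP (\sum_i wn i < \sum_i wp i).
  have [i0 ai0] := dec.1 lt.
  have [t Tt|T' hT'] := @waves_persist T i0; first by rewrite aT.
  by exists T' => i t Tt; rewrite hT'// neq_ltn ltnSn orbT.
have [t Tt i|T' hT'] := @waves_die T.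
  rewrite (aT _ Tt); apply/eqP; apply: contraNT ge; rewrite -lt0n => ai.
  by apply: dec.2; exists i.
by exists T' => i t Tt; rewrite hT'// eqxx.
Qed.

End Network.
End TokensAndWaves.

(** * The automata deciding a threshold *)

Section ThresholdAutomaton.
Local Open Scope nat_scope.
Variables (X : finType) (wp wn : X -> nat).

Definition weight_bound : nat := \max_x maxn (wp x) (wn x).
Local Notation L := weight_bound.

(** [None] marks a node that has not yet turned its initial value into credit and tokens. Afterwards
    the memory holds the credit, the emission modulo the degree and the color. *)
Definition threshold_memory (d : nat) : finType :=
  option ('I_L.+1 * 'I_d.+1 * 'I_3).
Definition threshold_message : finType := ('I_L.+1 * 'I_3)%type.

(** Here [r] is the port whose turn comes next and [c] the number of tokens to emit. *)
Definition threshold_emit d (a r c k : nat) :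
    threshold_memory d * d.-tuple threshold_message :=
  (Some (inord a, inord ((r + c) %% d), inord (k %% 3)),
   [tuple (inord (quota d i (r + c) - quota d i r), inord (k %% 3)) | i < d]).

Definition threshold_step d
    (s : node_state X bool (threshold_memory d) threshold_message d) :
    node_state X bool (threshold_memory d) threshold_message d :=
  let: (x, z, y, m) := s in
  match z with
  | None => let e := threshold_emit d (wp x) 0 (wn x) 0 in (x, e.1, y, e.2)
  | Some (a, r, k) =>
    let inflow := \sum_(v <- tval m) nat_of_ord v.1 in
    let fires := [|| k != 0 :> nat, 0 < a |
                     has (fun v => nat_of_ord v.2 == 1) (tval m)] in
    let e := threshold_emit d (a - inflow) r (inflow - a) (k + fires) in
    (x, e.1, Some fires, e.2)
  end.

Lemma threshold_step_input d s : (@threshold_step d s).1.1.1 = s.1.1.1.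
Proof. by case: s => [[[x [[[a r] k]|]] y] m]. Qed.

Definition threshold_algorithm : algorithm X bool :=
  @Algorithm X bool threshold_memory (fun=> None) threshold_message
    (ord0, ord0) threshold_step threshold_step_input.

Section Simulation.
Variables (n : nat) (N : network n) (x : {ffun 'I_n -> X}).

Let A := threshold_algorithm.
Let lg t := ledger_at N (wp \o x) (wn \o x) t.

Lemma wp_le_bound y : wp y <= L.
Proof. by rewrite (leq_trans (leq_maxl _ (wn y)))// (leq_bigmax y). Qed.

Lemma wn_le_bound y : wn y <= L.
Proof. by rewrite (leq_trans (leq_maxr (wp y) _))// (leq_bigmax y). Qed.

Definition ledger_memory t i : threshold_memory (degree N i) :=
  Some (inord (credit (lg t) i), inord (emitted (lg t) i %% degree N i),
        inord (height (lg t) i %% 3)).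

Definition ledger_messages t i : (degree N i).-tuple threshold_message :=
  [tuple (inord (flow N (lg t) i k), inord (height (lg t) i %% 3))
   | k < degree N i].

Lemma val_inord m k : k <= m -> (inord k : 'I_m.+1) = k :> nat.
Proof. by move=> km; rewrite inordK. Qed.

Lemma received_ledger t i :
  (forall j, (run A N x t.+1 j).2 = ledger_messages t j) ->
  val (received (run A N x t.+1) i) =
  [seq (inord (flow N (lg t) j (port_index N j i)),
        inord (height (lg t) j %% 3))
   | j <- neighbors N i] :> seq threshold_message.
Proof.
move=> msg; rewrite /=; apply/eq_in_map => j ji.
have ij : index i (neighbors N j) < degree N j.
  rewrite -[X in _ < X](size_tuple (neighbors N j)) index_mem.
  by rewrite mem_neighbors adj_sym -mem_neighbors.
by rewrite msg (nth_map (Ordinal ij)) ?size_enum_ord// nth_enum_ord.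
Qed.

Lemma inflow_ledger t i :
  (forall j, (run A N x t.+1 j).2 = ledger_messages t j) ->
  \sum_(v <- tval (received (run A N x t.+1) i)) nat_of_ord v.1 =
  inflow N (lg t) i.
Proof.
move=> msg; rewrite [tval _](received_ledger i msg) big_map.
apply: eq_bigr => j _; apply: val_inord.
by apply: flow_le => k; exact: wn_le_bound.
Qed.

Lemma fires_ledger t i :
  (forall j, (run A N x t.+1 j).2 = ledger_messages t j) ->
  [|| (inord (height (lg t) i %% 3) : 'I_3) != 0 :> nat,
      0 < (inord (credit (lg t) i) : 'I_L.+1) |
      has (fun v => nat_of_ord v.2 == 1) (tval (received (run A N x t.+1) i))] =
  fires N (lg t) i.
Proof.
move=> msg.
have h3 j : (inord (height (lg t) j %% 3) : 'I_3) = height (lg t) j %% 3 :> nat.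
  by apply: val_inord; rewrite -ltnS ltn_pmod.
rewrite h3 val_inord; last by apply: credit_le => k; exact: wp_le_bound.
rewrite [tval _](received_ledger i msg) has_map /fires.
by congr [|| _, _ | _]; apply: eq_has => j /=; rewrite h3.
Qed.

Lemma run_succ t i :
  (forall j, (run A N x t.+1 j).2 = ledger_messages t j) ->
  (run A N x t.+1 i).1.1 = (x i, ledger_memory t i) ->
  run A N x t.+2 i =
  let e := threshold_emit (degree N i) (credit (lg t) i - inflow N (lg t) i)
    (emitted (lg t) i %% degree N i) (inflow N (lg t) i - credit (lg t) i)
    (height (lg t) i %% 3 + fires N (lg t) i) in
  (x i, e.1, Some (fires N (lg t) i), e.2).
Proof.
move=> msg mem.
have -> : run A N x t.+2 i =
  threshold_step ((run A N x t.+1 i).1, received (run A N x t.+1) i) by [].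
move: (inflow_ledger i msg) (fires_ledger i msg).
move: (received _ i) => m inflowE firesE.
case: (run A N x t.+1 i).1 mem => xz y /= ->.
rewrite /threshold_step/ledger_memory firesE inflowE.
rewrite !val_inord ?credit_le// => [||k]; last exact: wp_le_bound.
  by rewrite -ltnS ltn_pmod.
by rewrite ltnW// ltn_pmod// degree_gt0.
Qed.

(** Time is shifted by one because the first step loads the initial values. Remainders of [emitted]
    suffice by [quotaD_mod]. *)
Lemma run_ledger t i :
  (run A N x t.+1 i).1.1 = (x i, ledger_memory t i) /\
  (run A N x t.+1 i).2 = ledger_messages t i.
Proof.
elim: t i => [|t IH] i; first by split.
rewrite run_succ => [|j|]; [|exact: (IH j).2|exact: (IH i).1].
split=> /=.
  by rewrite !modnDml.
apply: eq_from_tnth => k; rewrite !tnth_mktuple modnDml.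
by congr pair; rewrite /flow/= -quotaD_mod.
Qed.

Lemma run_output t i :
  output (run A N x t.+2) i =
  Some (height (lg t.+1) i != height (lg t) i).
Proof.
rewrite /output run_succ => [|j|]; first last.
- exact: (run_ledger t i).1.
- exact: (run_ledger t j).2.
congr Some; rewrite [height (lg t.+1) i]/= -{2}[height _ _]addn0 eqn_add2l.
by case: fires.
Qed.

End Simulation.

Lemma threshold_computable : computable_family
  (fun n _ (x : {ffun 'I_n -> X}) => \sum_i wn (x i) < \sum_i wp (x i)).
Proof.
exists threshold_algorithm => n N x.
have [T hT] := waves_decide N (wp \o x) (wn \o x).
exists T.+2 => i [|[|t]]// Tt; rewrite run_output hT//.
Qed.

End ThresholdAutomaton.

(** * Parallel execution of two algorithms *)

Section Combination.
Variables (X Y1 Y2 Y : finType) (g : Y1 -> Y2 -> Y).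
Variables (A1 : algorithm X Y1) (A2 : algorithm X Y2).

(** The outputs of both components are stored as well, because an automaton reads its own last
    output. *)
Definition pair_memory d : finType :=
  (memory A1 d * option Y1 * (memory A2 d * option Y2))%type.
Definition pair_message : finType := (message A1 * message A2)%type.
Local Notation state :=
  (fun d => node_state X Y (pair_memory d) pair_message d).

Definition state_fst d (s : state d) :
    node_state X Y1 (memory A1 d) (message A1) d :=
  let: (x, (z1, y1, _), _, m) := s in (x, z1, y1, map_tuple fst m).

Definition state_snd d (s : state d) :
    node_state X Y2 (memory A2 d) (message A2) d :=
  let: (x, (_, (z2, y2)), _, m) := s in (x, z2, y2, map_tuple snd m).

Definition pair_step d (s : state d) : state d :=
  let s1 := automaton (state_fst s) in
  let s2 := automaton (state_snd s) in
  (s.1.1.1, (s1.1.1.2, s1.1.2, (s2.1.1.2, s2.1.2)),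
   if (s1.1.2, s2.1.2) is (Some y1, Some y2) then Some (g y1 y2) else None,
   [tuple (tnth s1.2 k, tnth s2.2 k) | k < d]).

Definition pair_algorithm : algorithm X Y :=
  @Algorithm X Y pair_memory
    (fun d => (memory0 A1 d, None, (memory0 A2 d, None))) pair_message
    (message0 A1, message0 A2) pair_step (fun d s => erefl).

Lemma state_fst_step d (s : state d) :
  state_fst (pair_step s) = automaton (state_fst s).
Proof.
have := automaton_input (state_fst s).
rewrite /pair_step; move: (automaton (state_snd s)) => s2.
move: s => [[[x [[z1 y1] [z2 y2]]] y] m]/=.
case: automaton => [[[x' z'] y'] m'] /= ->; congr pair.
by apply: eq_from_tnth => k; rewrite tnth_map tnth_mktuple.
Qed.

Lemma state_snd_step d (s : state d) :
  state_snd (pair_step s) = automaton (state_snd s).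
Proof.
have := automaton_input (state_snd s).
rewrite /pair_step; move: (automaton (state_fst s)) => s1.
move: s => [[[x [[z1 y1] [z2 y2]]] y] m]/=.
case: automaton => [[[x' z'] y'] m'] /= ->; congr pair.
by apply: eq_from_tnth => k; rewrite tnth_map tnth_mktuple.
Qed.

Section Projections.
Variables (n : nat) (N : network n).

Lemma step_fst (c : configuration pair_algorithm N) (c1 : configuration A1 N) :
  (forall i, state_fst (c i) = c1 i) ->
  forall i, state_fst (step c i) = step c1 i.
Proof.
move=> cc1 i; rewrite /step.
have -> : (c1 i).1 = (state_fst (c i)).1 by rewrite cc1.
rewrite [LHS]state_fst_step; congr automaton.
case: (c i) => [[[x [[z1 y1] [z2 y2]]] y] m]; congr pair.
apply: val_inj; rewrite /= -map_comp; apply: eq_map => j /=.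
rewrite -cc1; case: (c j) => [[[xj [[z1j y1j] [z2j y2j]]] yj] mj]/=.
set k := index _ _.
(* Out of range, both sides are the default message. *)
have [km|km] := ltnP k (size mj); last by rewrite !nth_default// size_map.
by rewrite (nth_map (message0 A1, message0 A2)).
Qed.

Lemma step_snd (c : configuration pair_algorithm N) (c2 : configuration A2 N) :
  (forall i, state_snd (c i) = c2 i) ->
  forall i, state_snd (step c i) = step c2 i.
Proof.
move=> cc2 i; rewrite /step.
have -> : (c2 i).1 = (state_snd (c i)).1 by rewrite cc2.
rewrite [LHS]state_snd_step; congr automaton.
case: (c i) => [[[x [[z1 y1] [z2 y2]]] y] m]; congr pair.
apply: val_inj; rewrite /= -map_comp; apply: eq_map => j /=.
rewrite -cc2; case: (c j) => [[[xj [[z1j y1j] [z2j y2j]]] yj] mj]/=.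
set k := index _ _.
have [km|km] := ltnP k (size mj); last by rewrite !nth_default// size_map.
by rewrite (nth_map (message0 A1, message0 A2)).
Qed.

Lemma run_fst x t i : state_fst (run pair_algorithm N x t i) = run A1 N x t i.
Proof.
elim: t i => [|t IH] i; last exact: step_fst.
by congr pair; apply: val_inj; rewrite /= map_nseq.
Qed.

Lemma run_snd x t i : state_snd (run pair_algorithm N x t i) = run A2 N x t i.
Proof.
elim: t i => [|t IH] i; last exact: step_snd.
by congr pair; apply: val_inj; rewrite /= map_nseq.
Qed.

Lemma run_pair_output x t i : output (run pair_algorithm N x t.+1) i =
  if (output (run A1 N x t.+1) i, output (run A2 N x t.+1) i) is
    (Some y1, Some y2) then Some (g y1 y2) else None.
Proof.
rewrite /output -run_fst -run_snd.
by have -> : run pair_algorithm N x t.+1 i = pair_step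
  ((run pair_algorithm N x t i).1, received (run pair_algorithm N x t) i) by [].
Qed.

Lemma pair_terminates x y1 y2 :
  terminates_with A1 N x y1 -> terminates_with A2 N x y2 ->
  terminates_with pair_algorithm N x (g y1 y2).
Proof.
move=> [t1 T1] [t2 T2]; exists (maxn t1 t2).+1 => i [//|t].
rewrite ltnS geq_max => /andP[t1t t2t].
by rewrite run_pair_output T1 ?leqW// T2 ?leqW.
Qed.

End Projections.
End Combination.

Lemma eq_computable_family (X Y : finType)
    (f f' : forall n, (1 < n)%N -> {ffun 'I_n -> X} -> Y) :
  (forall n n1 x, f n n1 x = f' n n1 x) ->
  computable_family f -> computable_family f'.
Proof. by move=> ff' [A fA]; exists A => n N x; rewrite -ff'. Qed.

Lemma computable_combine (X Y1 Y2 Y : finType) (g : Y1 -> Y2 -> Y)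
    (f1 : forall n, (1 < n)%N -> {ffun 'I_n -> X} -> Y1)
    (f2 : forall n, (1 < n)%N -> {ffun 'I_n -> X} -> Y2) :
  computable_family f1 -> computable_family f2 ->
  computable_family (fun n n1 x => g (f1 n n1 x) (f2 n n1 x)).
Proof.
move=> [A1 T1] [A2 T2]; exists (pair_algorithm g A1 A2) => n N x.
by apply: pair_terminates; [exact: T1|exact: T2].
Qed.

(** * Approximation by finite unions of rational boxes *)

Section OuterMeasure.
Variables (R : realType) (m : nat).
Implicit Types S : set 'rV[R]_m.
Local Notation mu := (@lebesgue_outer R m).

Lemma volume_ge0 (a b : 'rV[R]_m) :
  (forall k, a 0 k < b 0 k) -> 0 <= volume a b.
Proof. by move=> ab; apply: prodr_ge0 => k _; rewrite subr_ge0 ltW. Qed.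

Lemma lebesgue_outer_cover S C : box_cover S C ->
  (mu S <= \esum_(B in C) (volume B.1 B.2)%:E)%E.
Proof. by move=> SC; apply: ereal_inf_lbound; exists C. Qed.

Lemma lebesgue_outer_ge0 S : (0 <= mu S)%E.
Proof.
apply: le_ereal_inf_tmp => _ [C [_ C0 _] <-].
by apply: esum_ge0 => B CB; rewrite lee_fin volume_ge0//; exact: C0.
Qed.

Lemma le_lebesgue_outer S S' : S `<=` S' -> (mu S <= mu S')%E.
Proof.
move=> SS'; apply: le_ereal_inf_tmp => _ [C [cC C0 SC] <-].
by apply: lebesgue_outer_cover; split => //; exact: subset_trans SC.
Qed.

Lemma lebesgue_outerU (A B : set 'rV[R]_m) : (mu (A `|` B) <= mu A + mu B)%E.
Proof.
have [->|fA] := eqVneq (mu A) +oo%E.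
  by rewrite addye ?leey// gt_eqF// (lt_le_trans _ (lebesgue_outer_ge0 B))//.
have [->|fB] := eqVneq (mu B) +oo%E.
  by rewrite addey ?leey// gt_eqF// (lt_le_trans _ (lebesgue_outer_ge0 A))//.
have finA : mu A \is a fin_num.
  by rewrite ge0_fin_numE ?lebesgue_outer_ge0// ltey.
have finB : mu B \is a fin_num.
  by rewrite ge0_fin_numE ?lebesgue_outer_ge0// ltey.
apply/lee_addgt0Pr => e e0; have e20 : 0 < e / 2 by rewrite divr_gt0.
have [_ [C [cC C0 AC] <-] ltC] := lb_ereal_inf_adherent e20 finA.
have [_ [D [cD D0 BD] <-] ltD] := lb_ereal_inf_adherent e20 finB.
have CD0 E : (C `|` D) E -> forall k, E.1 0 k < E.2 0 k.
  by case; [exact: C0|exact: D0].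
have cover : box_cover (A `|` B) (C `|` D).
  split => //.
    have -> : C `|` D = \bigcup_(b in [set: bool]) (if b then C else D).
      apply/seteqP; split=> [B' [CB|DB]|B' [[] _ ?]].
      - by exists true.
      - by exists false.
      - by left.
      - by right.
    by apply: bigcup_countable => // -[].
  by rewrite bigcup_setU; exact: setUSS.
apply: (le_trans (lebesgue_outer_cover cover)).
(* A box lying in both covers is counted once, with [C]. *)
rewrite (esumID C) => [|E CE]; last by rewrite lee_fin volume_ge0//; exact: CD0.
rewrite (_ : (C `|` D) `&` C = C); last first.
  by apply/seteqP; split=> ?; [case|split => //; left].
have : (\esum_(E in (C `|` D) `&` ~` C) (volume E.1 E.2)%:E <=
        \esum_(E in D) (volume E.1 E.2)%:E)%E.
  apply: ereal_sup_le => _ [X [finX XI] <-]; exists X => //; split => //.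
  by move=> E /XI[[]].
move=> /(leeD (lexx (\esum_(E in C) (volume E.1 E.2)%:E))%E)/le_trans; apply.
rewrite (le_trans (leeD (ltW ltC) (ltW ltD)))// addeACA -EFinD -splitr//.
Qed.

Lemma lebesgue_outer0 : (mu set0 <= 0)%E.
Proof.
rewrite -(esum_set0 (fun B : 'rV[R]_m * 'rV[R]_m => (volume B.1 B.2)%:E)).
by apply: lebesgue_outer_cover; split => // ? [].
Qed.

Lemma lebesgue_outer_seq (I : eqType) (s : seq I) (F : I -> set 'rV[R]_m) :
  (mu [set x | exists2 i, i \in s & F i x] <= \sum_(i <- s) mu (F i))%E.
Proof.
elim: s => [|i s IH].
  rewrite big_nil (le_trans _ lebesgue_outer0)// le_lebesgue_outer// => x.
  by case.
rewrite big_cons (le_trans _ (leeD (lexx _) IH))//.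
rewrite (le_trans _ (lebesgue_outerU _ _))// le_lebesgue_outer// => x [j].
by rewrite inE => /predU1P[->|js] Fjx; [left|right; exists j].
Qed.

Lemma lebesgue_outer_box (a b : 'rV[R]_m) : (forall k, a 0 k < b 0 k) ->
  (mu (open_box a b) <= (volume a b)%:E)%E.
Proof.
move=> ab; rewrite -(@esum_set1 R _ (a, b) (fun c => (volume c.1 c.2)%:E))//.
  apply: lebesgue_outer_cover; split; first exact: countable1.
    by move=> _ ->.
  by rewrite bigcup_set1.
by rewrite lee_fin volume_ge0.
Qed.

(** A crude converse of Bernoulli's inequality: in the induction, each of the three terms [x],
    [3 ^+ k * x] and [3 ^+ k * x * x] is at most [3 ^+ k * x]. *)
Lemma bernoulli_le k (x : R) : 0 <= x <= 1 -> (1 + x) ^+ k <= 1 + 3 ^+ k * x.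
Proof.
move=> /andP[x0 x1]; elim: k => [|k IH]; first by rewrite !expr0 mul1r lerDl.
rewrite !exprSr.
apply: (le_trans (ler_wpM2r _ IH)); first by rewrite addr_ge0.
have k1 : 1 <= 3 ^+ k :> R by rewrite exprn_ege1// ler1n.
have : 3 ^+ k * x * x <= 3 ^+ k * x.
  by rewrite ler_piMr// mulr_ge0// exprn_ge0.
have : x <= 3 ^+ k * x by rewrite ler_peMl.
lra.
Qed.

Lemma rational_outer_box (a b : 'rV[R]_m) (d : R) : 0 < d ->
  (forall k, a 0 k < b 0 k) ->
  exists B : 'rV[rat]_m * 'rV[rat]_m,
  let a' := map_mx ratr B.1 in let b' := map_mx ratr B.2 in
  [/\ forall k, a' 0 k < b' 0 k, open_box a b `<=` open_box a' b' &
      volume a' b' <= (1 + d) * volume a b].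
Proof.
(* Each endpoint moves outwards by less than [k0 / 2] times the side, so each side grows by a factor
   below [1 + k0]. By [bernoulli_le], this [k0] keeps [(1 + k0) ^+ m] at most [1 + d]. *)
move=> d0 ab; pose k0 : R := Num.min 1 (d / 3 ^+ m).
have k0gt0 : 0 < k0 by rewrite lt_min ltr01 divr_gt0// exprn_gt0.
have /choice[A /all_and2[A1 A2]] : forall k, exists q : rat,
    a 0 k - k0 / 2 * (b 0 k - a 0 k) < ratr q /\ ratr q < a 0 k.
  move=> k; have [|q] := @rat_in_itvoo R
    (a 0 k - k0 / 2 * (b 0 k - a 0 k)) (a 0 k).
    by rewrite ltrBlDr ltrDl mulr_gt0 ?subr_gt0// divr_gt0.
  by rewrite in_itv/= => /andP[? ?]; exists q.
have /choice[B /all_and2[B1 B2]] : forall k, exists q : rat,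
    b 0 k < ratr q /\ ratr q < b 0 k + k0 / 2 * (b 0 k - a 0 k).
  move=> k; have [|q] := @rat_in_itvoo R
    (b 0 k) (b 0 k + k0 / 2 * (b 0 k - a 0 k)).
    by rewrite ltrDl mulr_gt0 ?subr_gt0// divr_gt0.
  by rewrite in_itv/= => /andP[? ?]; exists q.
exists (\row_k A k, \row_k B k) => a' b'.
have a'E k : a' 0 k = ratr (A k) by rewrite !mxE.
have b'E k : b' 0 k = ratr (B k) by rewrite !mxE.
have ab' k : a' 0 k < b' 0 k.
  by rewrite a'E b'E (lt_trans (A2 k))// (lt_trans (ab k)).
split => //.
  move=> x xab k; rewrite a'E b'E; have /andP[ax xb] := xab k.
  by rewrite (lt_trans (A2 k))//= (lt_trans xb).
rewrite /volume.
apply: (@le_trans _ _ (\prod_k ((1 + k0) * (b 0 k - a 0 k)))).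
  apply: ler_prod => k _; rewrite subr_ge0 ltW//= a'E b'E.
  by have := A1 k; have := B2 k; lra.
rewrite big_split/= prodr_const card_ord ler_wpM2r//; first exact: volume_ge0.
apply: le_trans (@bernoulli_le m k0 _) _; first by rewrite ltW//= ge_min lexx.
rewrite lerD2l mulrC -ler_pdivlMr ?exprn_gt0// ge_min lexx orbT//.
Qed.

End OuterMeasure.

Section RationalApproximation.
Variables (R : realType) (m : nat).
Local Notation mu := (@lebesgue_outer R m).

Definition rational_union (F : seq ('rV[rat]_m * 'rV[rat]_m)) : set 'rV[R]_m :=
  [set x | exists2 B, B \in F & open_box (map_mx ratr B.1) (map_mx ratr B.2) x].

Lemma caratheodory_rational_approx (S : set 'rV[R]_m) (e : R) :
  caratheodory_measurable mu S -> (mu S < +oo)%E -> 0 < e ->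
  exists F,
    (mu ((S `\` rational_union F) `|` (rational_union F `\` S)) <= e%:E)%E.
Proof.
move=> Smeas Sfin e0.
have finS : mu S \is a fin_num by rewrite ge0_fin_numE ?lebesgue_outer_ge0.
pose M := fine (mu S); have ME : mu S = M%:E by rewrite fineK.
have M0 : 0 <= M by rewrite fine_ge0// lebesgue_outer_ge0.
(* One share [c] pays for the part of [S] that is missed, three shares for the excess. *)
pose c := e / 4; have c0 : 0 < c by rewrite divr_gt0.
have [_ [C [cC C0 SC] <-] ltC] := lb_ereal_inf_adherent c0 finS.
rewrite -/(mu S) ME -EFinD in ltC.
have v0 B : C B -> (0 <= (volume B.1 B.2)%:E)%E.
  by move=> CB; rewrite lee_fin volume_ge0//; exact: C0.
have finC : (\esum_(B in C) (volume B.1 B.2)%:E)%E \is a fin_num.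
  by rewrite ge0_fin_numE ?esum_ge0// (lt_trans ltC) ?ltry.
(* [G] is a finite subfamily of the cover carrying all but [c] of its total volume. *)
have [_ [G [finG GC] <-] ltG] := ub_ereal_sup_adherent c0 finC.
rewrite -/(esum _ _) (esumID G)// (setIidr GC) in ltG ltC finC.
have GE : (\esum_(B in G) (volume B.1 B.2)%:E =
    (\sum_(B <- fset_set G) volume B.1 B.2)%:E)%E.
  rewrite esum_fset// => [|B]; last by rewrite inE => /GC/v0.
  by rewrite fsbig_finite//= sumEFin.
have GE' : (\sum_(B \in G) (volume B.1 B.2)%:E =
    (\sum_(B <- fset_set G) volume B.1 B.2)%:E)%E.
  by rewrite fsbig_finite//= sumEFin.
set tail := (\esum_(B in C `&` ~` G) _)%E in ltG ltC finC.
rewrite GE in finC; rewrite GE in ltC; rewrite GE GE' in ltG.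
set V := \sum_(B <- fset_set G) _ in ltC ltG finC GE.
have V0 : 0 <= V.
  rewrite /V big_seq; apply: sumr_ge0 => B.
  by rewrite in_fset_set// inE => /GC/v0; rewrite lee_fin.
have tail0 : (0 <= tail)%E by apply: esum_ge0 => B [/v0].
have fint : tail \is a fin_num.
  by move: finC; rewrite fin_numD => /andP[].
pose t := fine tail; have tE : tail = t%:E by rewrite fineK.
rewrite tE -EFinD lte_fin in ltC; rewrite tE -EFinN -!EFinD lte_fin in ltG.
have tc : t <= c by lra.
have t0 : 0 <= t by rewrite -lee_fin -tE.
(* As [V] is at most [M + c], enlarging the boxes of [G] by the factor [1 + d] adds at most [c] to
   their volume. *)
pose d := c / (M + c + 1).
have d0 : 0 < d by rewrite divr_gt0//; lra.
have dV : d * V <= c.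
  rewrite /d mulrAC ler_pdivrMr; last by lra.
  by rewrite ler_wpM2l//; lra.
have /choice[rho rhoP] : forall B : 'rV[R]_m * 'rV[R]_m,
    exists B' : 'rV[rat]_m * 'rV[rat]_m, C B ->
    let a' := map_mx ratr B'.1 in let b' := map_mx ratr B'.2 in
    [/\ forall k, a' 0 k < b' 0 k, open_box B.1 B.2 `<=` open_box a' b' &
      volume a' b' <= (1 + d) * volume B.1 B.2].
  move=> B; have [CB|nCB] := pselect (C B); last by exists (0, 0).
  by have [B' ?] := rational_outer_box d0 (C0 B CB); exists B'.
pose F := [seq rho B | B <- fset_set G]; exists F.
(* [W] collects the dropped boxes; with it, the enlarged finite union still covers [S]. *)
pose W := \bigcup_(B in C `&` ~` G) open_box B.1 B.2.
have Wt : (mu W <= t%:E)%E.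
  rewrite -tE; apply: lebesgue_outer_cover; split => //.
    by apply: sub_countable cC; apply: subset_card_le => B [].
  by move=> B [/C0].
have muF : (mu (rational_union F) <= ((1 + d) * V)%:E)%E.
  apply: le_trans (lebesgue_outer_seq _ _) _.
  rewrite big_map big_seq mulr_sumr [X in (_ <= X%:E)%E]big_seq -sumEFin.
  apply: lee_sum => B; rewrite in_fset_set// inE => /GC/rhoP[ab _ vol].
  by apply: le_trans (lebesgue_outer_box ab) _; rewrite lee_fin.
have SFW : S `<=` W `|` rational_union F.
  move=> x /SC[B CB Bx]; have [GB|nGB] := pselect (G B); last by left; exists B.
  right; exists (rho B).
    by apply/mapP; exists B; rewrite ?in_fset_set ?inE.
  by have [_ + _] := rhoP B CB; exact.
have muWF : (mu (W `|` rational_union F) <= (t + (1 + d) * V)%:E)%E.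
  by rewrite EFinD (le_trans (lebesgue_outerU _ _))// leeD.
have muD : (mu ((W `|` rational_union F) `\` S) <= (3 * c)%:E)%E.
  (* Caratheodory's condition, tested on a superset of [S], makes the excess the difference of two
     measures; subtracting [M] is legitimate since it is finite. *)
  have := Smeas (W `|` rational_union F).
  rewrite (setIidr SFW) ME -setDE => E; rewrite E in muWF.
  have : ((M%:E + mu ((W `|` rational_union F) `\` S)) <= (M + 3 * c)%:E)%E.
    by apply: le_trans muWF _; rewrite lee_fin mulrDl mul1r; lra.
  by rewrite EFinD leeD2lE.
apply: le_trans (lebesgue_outerU _ _) _.
apply: (@le_trans _ _ (t%:E + (3 * c)%:E)%E).
  apply: leeD.
    apply: le_trans Wt; apply: le_lebesgue_outer => x [Sx nF].
    by have [|] := SFW x Sx.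
  by apply: le_trans muD; apply: le_lebesgue_outer; apply: setSD => x; right.
by rewrite -EFinD lee_fin /c; rewrite /c in tc; lra.
Qed.

End RationalApproximation.

(** * Box functions on the simplex *)

Section SimplexFunctions.
Variables (R : realType) (K : nat).
Local Notation D := (simplex R K).

Lemma computable_on_combine (Y1 Y2 Y : finType) (g : Y1 -> Y2 -> Y)
    (h1 : D -> Y1) (h2 : D -> Y2) :
  computable_on_simplex h1 -> computable_on_simplex h2 ->
  computable_on_simplex (fun p => g (h1 p) (h2 p)).
Proof. exact: computable_combine. Qed.

(** Multiplying by [d] and [n] turns the comparison of a frequency with a rational into one of sums
    of node weights. Writing the numerator as a difference keeps the weights natural. *)
Lemma freq_threshold (P Q d : nat) (d0 : (0 < d)%N) (k : 'I_K.+1) n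
    (n1 : (1 < n)%N) (x : {ffun 'I_n -> 'I_K.+1}) :
  ((P%:R - Q%:R) / d%:R < val (freq_simplex R n1 x) 0 k) =
    (\sum_(i < n) P < \sum_i (d * (x i == k) + Q))%N /\
  (val (freq_simplex R n1 x) 0 k < (P%:R - Q%:R) / d%:R) =
    (\sum_i (d * (x i == k) + Q) < \sum_(i < n) P)%N.
Proof.
have n0 : 0 < n%:R :> R by rewrite ltr0n ltnW.
have dR0 : 0 < d%:R :> R by rewrite ltr0n.
rewrite sum_nat_const card_ord big_split/= sum_nat_const card_ord -big_distrr/=.
rewrite (_ : \sum_i _ = #|[pred i | x i == k]|)%N; last first.
  rewrite -sum1_card [RHS]big_mkcond/=; apply: eq_bigr => i _.
  by rewrite inE; case: eqP.
rewrite mxE; move: #|_| => c.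
rewrite -!(ltr_nat R) !natrD !natrM ltr_pdivrMr// ltr_pdivlMr// mulrAC.
by rewrite ltr_pdivlMr// ltr_pdivrMr// mulrBl !ltrBlDr !ltrBrDr ![_ * d%:R]mulrC
   ![_ * n%:R]mulrC.
Qed.

Lemma ratr_natE (a : rat) : exists P Q d : nat, (0 < d)%N /\
  ratr a = (P%:R - Q%:R) / d%:R :> R.
Proof.
case: (ratP a) => nu d _; rewrite fmorph_div/= ratr_int ratr_nat.
case: nu => u; [exists u, 0%N, d.+1|exists 0%N, u.+1, d.+1]; split => //.
  by rewrite subr0.
by rewrite NegzE sub0r rmorphN.
Qed.

Lemma computable_gt (a : rat) (k : 'I_K.+1) :
  computable_on_simplex (fun p : D => ratr a < val p 0 k).
Proof.
have [P [Q [d [d0 ->]]]] := ratr_natE a.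
apply: eq_computable_family => [n n1 x|].
  exact/esym/(freq_threshold P Q d0 k n1 x).1.
exact: (@threshold_computable _ (fun y => (d * (y == k) + Q)%N) (fun=> P)).
Qed.

Lemma computable_lt (a : rat) (k : 'I_K.+1) :
  computable_on_simplex (fun p : D => val p 0 k < ratr a).
Proof.
have [P [Q [d [d0 ->]]]] := ratr_natE a.
apply: eq_computable_family => [n n1 x|].
  exact/esym/(freq_threshold P Q d0 k n1 x).2.
exact: (@threshold_computable _ (fun=> P) (fun y => (d * (y == k) + Q)%N)).
Qed.

Lemma computable_cst (Y : finType) (y : Y) :
  computable_on_simplex (fun _ : D => y).
Proof.
by apply: (computable_on_combine (fun _ _ => y) (computable_gt 0 ord0)
  (computable_gt 0 ord0)).
Qed.

Definition in_rational_box (B : 'rV[rat]_K.+1 * 'rV[rat]_K.+1) (p : D) : bool :=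
  all (fun k => (ratr (B.1 0 k) < val p 0 k) && (val p 0 k < ratr (B.2 0 k)))
      (enum 'I_K.+1).

Lemma in_rational_boxE B p :
  in_rational_box B p <-> @rational_box R K B.1 B.2 (val p).
Proof.
split.
  move=> /allP Bp k; rewrite !mxE; exact/Bp/mem_enum.
by move=> Bp; apply/allP => k _; have := Bp k; rewrite !mxE.
Qed.

Lemma computable_in_box B : computable_on_simplex (in_rational_box B).
Proof.
rewrite /in_rational_box; elim: (enum _) => [|k s IH] /=.
  exact: computable_cst.
apply: (computable_on_combine andb) IH.
exact: computable_on_combine (computable_gt _ _) (computable_lt _ _).
Qed.

(** A decision list: the first box containing [p] gives the value. Unlike a sum over boxes, it takes
    values in [Y] even where boxes overlap. *)
Definition decision (Y : Type) (y0 : Y)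
    (s : seq (Y * ('rV[rat]_K.+1 * 'rV[rat]_K.+1))) (p : D) : Y :=
  foldr (fun c y => if in_rational_box c.2 p then c.1 else y) y0 s.

Lemma decision_computable (Y : finType) (y0 : Y) s :
  computable_on_simplex (decision y0 s).
Proof.
elim: s => [|[y B] s IH]; first exact: computable_cst.
exact: (computable_on_combine (fun (b : bool) y' => if b then y else y')
  (computable_in_box B) IH).
Qed.

Lemma decisionP (Y : eqType) (y0 : Y) s p :
  (exists2 c, c \in s & in_rational_box c.2 p /\ decision y0 s p = c.1) \/
  (forall c, c \in s -> ~~ in_rational_box c.2 p).
Proof.
elim: s => [|c s IH]; first by right.
rewrite /=; case: ifPn => [cp|ncp].
  by left; exists c; rewrite ?mem_head.
case: IH => [[c' c's ?]|sp]; first by left; exists c'; rewrite // inE c's orbT.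
by right=> c'; rewrite inE => /predU1P[->//|/sp].
Qed.

Lemma indic_in_box B (p : D) :
  \1_(@rational_box R K B.1 B.2) (val p) = (in_rational_box B p)%:R :> R.
Proof.
rewrite indicE; congr (_%:R); congr nat_of_bool.
by apply/idP/idP; rewrite inE => /in_rational_boxE.
Qed.

Definition box_sum (s : seq (R * ('rV[rat]_K.+1 * 'rV[rat]_K.+1))) (p : D) :=
  \sum_(c <- s) c.1 * (in_rational_box c.2 p)%:R.

Lemma box_functionE (g : D -> R) : box_function g <-> exists s, g =1 box_sum s.
Proof.
split=> -[s gs]; exists s => p; rewrite gs; apply: eq_bigr => c _.
  by rewrite indic_in_box.
by rewrite indic_in_box.
Qed.

Lemma box_cst (c : R) : box_function (fun _ : D => c).
Proof.
(* The cube with sides from -1 to 2 contains the simplex. *)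
apply/box_functionE; exists [:: (c, (const_mx (-1), const_mx 2))] => p.
rewrite /box_sum big_seq1 (_ : in_rational_box _ _) ?mulr1//.
apply/allP => k _; rewrite !mxE rmorphN rmorph1 ratr_nat.
have /andP[/forallP/(_ k)/andP[p0 p1] _] := valP p.
by apply/andP; split; lra.
Qed.

Lemma box_in_box B : box_function (fun p => (in_rational_box B p)%:R).
Proof.
apply/box_functionE; exists [:: (1, B)] => p.
by rewrite /box_sum big_seq1 mul1r.
Qed.

Lemma box_add g1 g2 : box_function g1 -> box_function g2 ->
  box_function (fun p : D => g1 p + g2 p).
Proof.
move=> /box_functionE[s1 g1s] /box_functionE[s2 g2s]; apply/box_functionE.
by exists (s1 ++ s2) => p; rewrite g1s g2s /box_sum big_cat.
Qed.

(** For disjoint boxes the corners may come out in the wrong order; the box is then empty, as it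
    should be. *)
Definition box_inter (B B' : 'rV[rat]_K.+1 * 'rV[rat]_K.+1) :=
  (\row_k Num.max (B.1 0 k) (B'.1 0 k), \row_k Num.min (B.2 0 k) (B'.2 0 k)).

Lemma in_box_inter B B' p :
  in_rational_box (box_inter B B') p =
  in_rational_box B p && in_rational_box B' p.
Proof.
rewrite /in_rational_box -all_predI; apply: eq_all => k /=; rewrite !mxE.
rewrite andbACA; congr andb.
  case: (leP (B.1 0 k)) => [le|/ltW le]; apply/esym.
    by rewrite andb_idl// => lt; apply: le_lt_trans lt; rewrite ler_rat.
  by rewrite andb_idr// => lt; apply: le_lt_trans lt; rewrite ler_rat.
case: (leP (B.2 0 k)) => [le|/ltW le]; apply/esym.
  by rewrite andb_idr// => /lt_le_trans; apply; rewrite ler_rat.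
by rewrite andb_idl// => /lt_le_trans; apply; rewrite ler_rat.
Qed.

Lemma box_mul g1 g2 : box_function g1 -> box_function g2 ->
  box_function (fun p : D => g1 p * g2 p).
Proof.
move=> /box_functionE[s1 g1s] /box_functionE[s2 g2s]; apply/box_functionE.
exists [seq (c.1 * c'.1, box_inter c.2 c'.2) | c <- s1, c' <- s2] => p.
rewrite g1s g2s /box_sum big_allpairs_dep mulr_suml; apply: eq_bigr => c _.
rewrite mulr_sumr; apply: eq_bigr => c' _ /=.
by rewrite in_box_inter -mulnb natrM mulrACA.
Qed.

Lemma decision_box (y0 : R) s : box_function (decision y0 s).
Proof.
elim: s => [|[y B] s IH]; first exact: box_cst.
(* The case distinction is written as a polynomial in the indicator, so that closure under sums and
   products applies. *)
suff -> : decision y0 ((y, B) :: s) = (fun p => (in_rational_box B p)%:R * y +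
    (1 + -1 * (in_rational_box B p)%:R) * decision y0 s p) :> (D -> R).
  have ind := box_in_box B.
  apply: box_add; apply: box_mul => //; first exact: box_cst.
  by apply: box_add; [exact: box_cst|apply: box_mul => //; exact: box_cst].
apply/funext => p /=; case: in_rational_box => /=; ring.
Qed.

Lemma map_decision (Y Y' : Type) (f : Y -> Y') y0 s p :
  f (decision y0 s p) = decision (f y0) [seq (f c.1, c.2) | c <- s] p.
Proof. by elim: s => //= c s <-; case: ifP. Qed.

Lemma simplex_coord_inj : injective (@simplex_coord R K).
Proof.
move=> p q pq; have E k : val p 0 (lift ord0 k) = val q 0 (lift ord0 k).
  by have := congr1 (fun v : 'rV_K => v 0 k) pq; rewrite !mxE.
have /andP[_ /eqP sp] := valP p; have /andP[_ /eqP sq] := valP q.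
apply: val_inj; apply/rowP => k.
have [j ->|->] := unliftP ord0 k; first exact: E.
move: sp; rewrite -sq !big_ord_recl (eq_bigr _ (fun k _ => E k)).
exact: addIr.
Qed.

(* The 0-th coordinate of a point of the simplex lies in ]-1, 2[, so that
   boxes in the affine coordinates extend to boxes of the ambient space. *)
Definition box_extend (B : 'rV[rat]_K * 'rV[rat]_K) :
    'rV[rat]_K.+1 * 'rV[rat]_K.+1 :=
  (\row_k oapp (B.1 0) (-1) (unlift ord0 k),
   \row_k oapp (B.2 0) 2 (unlift ord0 k)).

Lemma in_box_extend B (p : D) : in_rational_box (box_extend B) p <->
  open_box (map_mx ratr B.1) (map_mx ratr B.2) (simplex_coord p).
Proof.
split=> [/allP Bp k|Bp].
  by have := Bp (lift ord0 k) (mem_enum _ _); rewrite /= !mxE liftK.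
apply/allP => k _; have [j ->|->] := unliftP ord0 k.
  by have := Bp j; rewrite /= !mxE liftK.
have /andP[/forallP/(_ ord0)/andP[p0 p1] _] := valP p.
rewrite /= !mxE unlift_none/= rmorphN rmorph1 ratr_nat.
by apply/andP; split; lra.
Qed.

Lemma simplex_measure_fin (S : set D) : (simplex_measure S < +oo)%E.
Proof.
apply: (@le_lt_trans _ _ (lebesgue_outer
    (open_box (const_mx (-1)) (const_mx 2) : set 'rV[R]_K))).
  apply: le_lebesgue_outer => _ [p _ <-] k; rewrite !mxE.
  have /andP[/forallP/(_ (lift ord0 k))/andP[p0 p1] _] := valP p.
  by apply/andP; split; lra.
apply: (@le_lt_trans _ _ (volume (const_mx (-1)) (const_mx 2))%:E).
  by apply: lebesgue_outer_box => k; rewrite !mxE; lra.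
exact: ltry.
Qed.

End SimplexFunctions.

(** * From approximated level sets to a decision list *)

Theorem corollary9p4 (R : realType) (K : nat) (Y : {fset R})
    (h : simplex R K -> Y) :
  (forall y : Y, simplex_measurable [set p | h p = y]) ->
  forall eps : R, 0 < eps ->
  exists h_eps : simplex R K -> Y,
    [/\ computable_on_simplex h_eps,
        box_function (fun p => val (h_eps p)) &
        (simplex_measure [set p | h p <> h_eps p] <= eps%:E)%E].
Proof.
move=> hmeas eps eps0.
(* Any value of [h] serves as default and shows that [Y] is nonempty; the frequencies of a constant
   word provide a point of the simplex. *)
pose y0 := h (freq_simplex R (n := 2) isT [ffun=> ord0]).
pose L y := @simplex_coord R K @` [set p | h p = y].
pose e := eps / #|{: Y}|%:R.
have Y0 : 0 < #|{: Y}|%:R :> R by rewrite ltr0n; apply/card_gt0P; exists y0.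
have /choice[F LF] : forall y, exists F : seq ('rV[rat]_K * 'rV[rat]_K),
    (lebesgue_outer ((L y `\` @rational_union R K F) `|`
      (@rational_union R K F `\` L y)) <= e%:E)%E.
  move=> y; apply: caratheodory_rational_approx; first exact: hmeas.
    exact: simplex_measure_fin.
  by rewrite divr_gt0.
pose s := [seq (y, box_extend B) | y <- enum {: Y}, B <- F y].
exists (decision y0 s); split; first exact: decision_computable.
  under [X in box_function X]eq_fun do rewrite map_decision.
  exact: decision_box.
apply: (@le_trans _ _ (\sum_(y <- enum {: Y}) e%:E)%E); last first.
  rewrite big_enum/= sumEFin sumr_const lee_fin /e.
  by rewrite -[leLHS]mulr_natr divfK// gt_eqF.
(* It remains to place each point of disagreement in the symmetric difference of some level set and
   its approximating union. *)
apply: (le_trans _ (lee_sum _ (fun y _ => LF y))).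
apply: le_trans (lebesgue_outer_seq _ _); apply: le_lebesgue_outer.
move=> _ [p /= hp <-].
have LE y : L y (simplex_coord p) <-> h p = y.
  by split=> [[q hq /simplex_coord_inj <-]|hpy]; [|exists p].
have FE y : @rational_union R K (F y) (simplex_coord p) <->
    exists2 c, c \in s & c.1 = y /\ in_rational_box c.2 p.
  split.
    move=> [B BF Bp]; exists (y, box_extend B); last first.
      by split=> //; apply/in_box_extend.
    by apply/allpairsPdep; exists y, B; rewrite mem_enum.
  move=> [_ /allpairsPdep[y' [B [_ BF ->]]]
    [/= <- /in_box_extend Bp]].
  by exists B.
(* If a box decides [p], its value differs from [h p], so [p] is in the excess of the union for that
   value. *)
have [[c cs [cp cE]]|nos] := decisionP y0 s p.
  exists c.1; first by rewrite mem_enum.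
  right; split; first by apply/FE; exists c.
  by move=> /LE hc; apply: hp; rewrite hc.
(* If no box contains [p], the union for [h p] misses it. *)
exists (h p); first by rewrite mem_enum.
left; split; first exact/LE.
by move=> /FE[c /nos/negP nc [_ cp]].
Qed.
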